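(* For every integer $c>1$, there exists a transitive action of $\mathrm{SL}_2(2^c)$ on a set $\Omega$ such that $\mathrm{B}(\mathrm{SL}_2(2^c),\Omega)\ge c$.
   Context: Let $G$ act on a set $\Omega$. A finite sequence $\Lambda$ of points of $\Omega$ is a base if its pointwise stabilizer in $G$ is trivial, and is a minimal base if it is a base and no proper subsequence of it is a base. $\mathrm{B}(G,\Omega)$ is the maximum size of a minimal base. *)

(* Defs.v *)
From mathcomp Require Import all_boot all_order all_algebra all_fingroup.

Set Implicit Arguments.
Unset Strict Implicit.
Unset Printing Implicit Defensive.

Import GroupScope.

Section SpecialLinearGroup.

Variables (n : nat) (R : finComUnitRingType).

Definition SL_set := [set u : {'GL_n[R]} | (\det u == 1)%R].

Lemma SL_group_set : group_set SL_set.
Proof.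
apply/group_setP; split=> [|u v]; first by rewrite inE GL_1E det1.
by rewrite !inE GL_ME => /eqP du /eqP dv; rewrite det_mulmx du dv GRing.mulr1.
Qed.

Canonical SL_group := Group SL_group_set.

End SpecialLinearGroup.

Notation "''SL_' n [ R ]" := (SL_group n R)
  (at level 8, n at level 2, format "''SL_' n [ R ]") : Group_scope.
Notation "''SL_' n [ R ]" := (SL_set n R) (only parsing) : group_scope.

Section Bases.

Variables (gT : finGroupType) (G : {group gT}) (T : finType).
(* The elements of gT outside G need not act; 'C(S | to) is the pointwise
   stabiliser of S in the domain G of to. *)
Variable to : action G T.

Definition is_base (s : seq T) := 'C([set x in s] | to) == 1.

(* The subsequences of s are the mask m s with m of length size s. *)
Definition minimal_base (s : seq T) :=
  is_base s &&
  [forall m : (size s).-tuple bool, (mask m s != s) ==> ~~ is_base (mask m s)].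

(* A minimal base has no repeated point, so its size is at most #|T|; the
   lemmas below show that max_minimal_base is the maximum size of a minimal
   base whenever there is one. It is 0 if the action is not faithful, as there
   is then no base. *)
Definition max_minimal_base :=
  \max_(n < #|T|.+1 | [exists s : n.-tuple T, minimal_base s]) n.

Lemma minimal_baseP (s : seq T) :
  reflect (is_base s /\ forall s', subseq s' s -> s' != s -> ~~ is_base s')
          (minimal_base s).
Proof.
apply: (iffP andP) => -[bs min_s]; split=> //.
  move=> _ /subseqP[m /eqP sz_m ->] ne_s.
  by have /implyP := forallP min_s (Tuple sz_m); apply.
by apply/forallP=> m; apply/implyP; apply: min_s; apply: mask_subseq.
Qed.

Lemma minimal_base_uniq (s : seq T) : minimal_base s -> uniq s.
Proof.
case/minimal_baseP=> bs min_s; case: (eqVneq (undup s) s) => [<-|ne_s].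
  exact: undup_uniq.
case/negP: (min_s _ (undup_subseq s) ne_s); move: bs; rewrite /is_base.
by congr ('C(_ | to) == 1); apply/setP=> x; rewrite !inE mem_undup.
Qed.

Lemma max_minimal_base_ge (s : seq T) :
  minimal_base s -> size s <= max_minimal_base.
Proof.
move=> min_s; have sz_s: size s < #|T|.+1.
  by rewrite ltnS -(card_uniqP (minimal_base_uniq min_s)) max_card.
apply: (leq_bigmax_cond (Ordinal sz_s)).
by apply/existsP; exists (in_tuple s).
Qed.

Lemma max_minimal_base_attained (s : seq T) :
  minimal_base s -> exists2 s', minimal_base s' & size s' = max_minimal_base.
Proof.
move=> min_s; have sz_s: size s < #|T|.+1.
  by rewrite ltnS -(card_uniqP (minimal_base_uniq min_s)) max_card.
have Ps: [exists t : (Ordinal sz_s).-tuple T, minimal_base t].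
  by apply/existsP; exists (in_tuple s).
rewrite /max_minimal_base (bigmax_eq_arg (Ordinal sz_s)) //.
case: arg_maxnP => //= i /existsP[t min_t] _.
by exists t; rewrite ?size_tuple.
Qed.

End Bases.

(* Main.v *)
Require Import Defs.
From mathcomp Require Import all_boot all_order all_algebra all_fingroup.
From mathcomp Require Import pgroup sylow finfield.

Set Implicit Arguments.
Unset Strict Implicit.
Unset Printing Implicit Defensive.

Import GroupScope.

(** Let U be the group of unitriangular matrices of SL_2(F): it is elementary
    abelian of order 2 ^ c. The group acts on the cosets of a subgroup H of
    index 2 in U, so that the point stabilisers are the conjugates of H.

    The normaliser of U contains the diagonal matrices diag(a, 1/a), which
    multiply the off-diagonal entry of an element of U by a ^ 2. As every
    element of F is a square in characteristic 2, the normaliser of U is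
    transitive on the nontrivial elements of U; a nontrivial element common to
    the conjugates of H under N(U) would thus drag all of U into H. Hence the
    cosets H x with x in N(U) form a base (trans_norm_unitri and
    fusion_minimal_base).

    Any base contains a minimal one (minimal_base_sub). A minimal base taken
    from those cosets is long, because each of its points is stabilised by a
    subgroup of index 2 in U: k such subgroups intersect in a subgroup of index
    at most 2 ^ k (leq_index_astab), and the index must be 2 ^ c for the
    intersection to be trivial, so k >= c. This counting replaces the explicit
    choice of c independent hyperplanes of F over its prime field. *)

Lemma leq_indexI (gT : finGroupType) (A K L : {group gT}) :
  #|A : K :&: L| <= #|A : K| * #|A : L|.
Proof.
rewrite -(indexgI A (K :&: L)) /= setIA.
rewrite -(Lagrange_index (subsetIl A K) (subsetIl _ L)) !indexgI leq_mul2l.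
by rewrite (subset_leq_card (imsetS _ (subsetIl A K))) orbT.
Qed.

Section MinimalBases.

Variables (gT : finGroupType) (G : {group gT}) (T : finType).
Variable to : action G T.

(** Keep deleting points as long as some proper subsequence is a base. *)
Lemma minimal_base_sub (s : seq T) :
  is_base to s -> exists2 s', subseq s' s & minimal_base to s'.
Proof.
have [n] := ubnP (size s); elim: n s => // n IHn s lt_sn bs.
have [min_s | ] := boolP (minimal_base to s); first by exists s.
rewrite /minimal_base bs negb_forall => /existsP[m].
rewrite negb_imply negbK => /andP[ne_ms bms].
have sub_ms: subseq (mask m s) s := mask_subseq m s.
have [|s' sub_s' min_s'] := IHn _ _ bms.
  rewrite -ltnS (leq_trans _ lt_sn) // ltnS ltn_neqAle size_subseq // andbT.
  by rewrite (size_subseq_leqif sub_ms).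
by exists s' => //; apply: subseq_trans sub_ms.
Qed.

Lemma leq_index_astab (A : {group gT}) (p : nat) (s : seq T) :
    A \subset G -> {in s, forall x, #|A : 'C[x | to]| <= p} ->
  #|A : 'C([set x in s] | to)| <= p ^ size s.
Proof.
move=> sAG; elim: s => [|x s IHs] le_p.
  have sAC: A \subset 'C([set x in [::]] | to).
    apply: subset_trans sAG _; apply/subsetP=> a Ga; rewrite !inE Ga.
    by apply/subsetP=> y; rewrite inE.
  by have /eqP-> : #|A : 'C([set x in [::]] | to)| == 1%N by rewrite indexg_eq1.
rewrite set_cons astabU expnS (leq_trans (leq_indexI _ _ _)) // leq_mul //.
  by apply: le_p; rewrite mem_head.
by apply: IHs => y s_y; apply: le_p; rewrite inE s_y orbT.
Qed.

(** A lower bound for the size of a minimal base that does not construct one: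
    every base inside X has at least c points, since each point divides the
    order of the stabiliser in A by at most p. *)
Lemma leq_max_minimal_base (A : {group gT}) (X : {set T}) (p c : nat) :
    A \subset G -> 1 < p -> #|A| = (p ^ c)%N ->
    {in X, forall x, #|A : 'C[x | to]| <= p} -> 'C(X | to) = 1 ->
  c <= max_minimal_base to.
Proof.
move=> sAG p_gt1 oA le_p CX1.
have bX: is_base to (enum X).
  rewrite /is_base (_ : [set x in _] = X) ?CX1 //.
  by apply/setP=> x; rewrite inE mem_enum.
have [s sub_s min_s] := minimal_base_sub bX.
apply: leq_trans (max_minimal_base_ge min_s).
have /andP[/eqP Cs1 _] := min_s.
rewrite -(leq_exp2l _ _ p_gt1) -oA -indexg1 -Cs1 leq_index_astab // => x s_x.
by apply: le_p; rewrite -mem_enum (mem_subseq sub_s).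
Qed.

End MinimalBases.

(** The coset space, packaged as an action whose domain is G itself. As 'Rs
    acts on all sets of elements of gT, it is cut down to the cosets of H in G,
    then its domain is reduced to G. *)
Lemma coset_action_exists (gT : finGroupType) (G H : {group gT}) :
    H \subset G ->
  exists (Omega : finType) (to : action G Omega) (w : Omega),
    [transitive G, on [set: Omega] | to] /\ 'C[w | to] = H.
Proof.
move=> sHG; pose P := [pred X : {set gT} | X \in rcosets H G].
have sGD: G \subset subact_dom P 'Rs.
  rewrite /subact_dom (_ : [set X | P X] = rcosets H G) ?actsRs_rcosets //.
  by apply/setP=> X; rewrite inE.
pose to := ('Rs^? \ sGD : action G {X | P X})%act.
have val_to u a : a \in G -> val (to u a) = val u :* a.
  by move=> Ga; rewrite val_subact (subsetP sGD) //= rcosetE.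
have PH: P (H : {set gT}) by apply/rcosetsP; exists 1; rewrite ?rcoset1.
pose w : {X | P X} := Sub (H : {set gT}) PH.
exists {X | P X}, to, w; split.
  apply/imsetP; exists w => //; apply/setP=> u; rewrite inE; apply/esym.
  have /rcosetsP[a Ga def_u] := valP u.
  by apply/orbitP; exists a => //; apply: val_inj; rewrite val_to.
rewrite astab_ract astab_subact setIA (setIidPl sGD) imset_set1 /= astab1Rs.
exact/setIidPr.
Qed.

(** The points are the cosets of a subgroup H of index p in U. Since 'N_G(U)
    fuses the nontrivial elements of U, the conjugates of H under 'N_G(U) have
    trivial intersection, and all of them have index p in U. *)
Lemma fusion_minimal_base (gT : finGroupType) (G U : {group gT}) (p c : nat) :
    prime p -> 0 < c -> U \subset G -> #|U| = (p ^ c)%N ->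
    [transitive 'N_G(U), on U^# | 'J] ->
  exists (Omega : finType) (to : action G Omega),
    [transitive G, on [set: Omega] | to] /\ c <= max_minimal_base to.
Proof.
case: c => // c p_pr _ sUG oU trU.
have pU: p.-group U by rewrite /pgroup oU pnatX pnat_id.
have [|H [sHU _ oH]] := @normal_pgroup p gT c U U pU (normal_refl U).
  by rewrite oU pfactorK.
have [Omega [to [w [trG Cw]]]] := coset_action_exists (subset_trans sHU sUG).
exists Omega, to; split=> //.
have Cwx x : x \in G -> 'C[to w x | to] = H :^ x.
  by move=> Gx; rewrite astab1_act_in // Cw.
apply: (leq_max_minimal_base (X := to w @: 'N_G(U)) sUG (prime_gt1 p_pr) oU).
  move=> _ /imsetP[x /setIP[Gx Nx] ->]; rewrite Cwx // -(normP Nx) indexJg.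
  by rewrite -divgS // oU oH expnS mulnK // expn_gt0 prime_gt0.
apply/trivgP/subsetP=> h Ch; rewrite inE; apply: contraTT isT => nt_h.
(* A nontrivial element h of all the conjugates of H has all its own
   conjugates under 'N_G(U) in H, and these exhaust U^#. *)
have HhN x : x \in 'N_G(U) -> h \in H :^ x.
  move=> Nx; have /setIP[Gx _] := Nx; rewrite -Cwx //.
  by apply: (subsetP _ _ Ch); rewrite astabS // sub1set imset_f.
have Hh: h \in H by rewrite -(conjsg1 H) HhN.
have: U \subset H.
  apply/subsetP=> u Uu; have [-> // | nt_u] := eqVneq u 1.
  have [y Ny ->]: exists2 y, y \in 'N_G(U) & u = h ^ y.
    have Uh: h \in U^# by apply/setD1P; rewrite (subsetP sHU).
    have [|y Ny def_u] := atransP2 trU Uh (_ : u \in U^#); first exact/setD1P.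
    by exists y.
  by have := HhN _ (groupVr Ny); rewrite mem_conjgV.
move/subset_leq_card; rewrite oU oH leqNgt ltn_exp2l ?prime_gt1 //.
by rewrite ltnSn.
Qed.

Section Borel.

Variable F : finFieldType.
Local Open Scope ring_scope.
Implicit Types a b : F.

(** The lower triangular matrices of determinant 1 (for a != 0). Lower rather
    than upper triangular, so that det_trig gives the determinant. *)
Definition borel_mx a b : 'M[F]_2 :=
  \matrix_(i, j) if i == 0 then if j == 0 then a else 0
                 else if j == 0 then b else a^-1.

Lemma det_borel_mx a b : a != 0 -> \det (borel_mx a b) = 1.
Proof.
move=> nz_a; rewrite det_trig ?big_ord_recl ?big_ord0 ?mxE /=.
  by rewrite GRing.mulr1 GRing.divff.
by apply/is_trig_mxP=> [[[|[|i]] //= ?] [[|[|j]] //= ?]] _; rewrite mxE.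
Qed.

Lemma mul_borel_mx a b a' b' :
  borel_mx a b *m borel_mx a' b' = borel_mx (a * a') (b * a' + a^-1 * b').
Proof.
apply/matrixP=> i j; rewrite !mxE !big_ord_recl big_ord0 !mxE /=.
rewrite GRing.invfM.
do 2!case: ifP => _.
all: by rewrite ?(GRing.mul0r, GRing.mulr0, GRing.addr0, GRing.add0r).
Qed.

(** The default value 1 is only taken at a = 0, where the matrix is singular. *)
Definition borel a b : {'GL_2[F]} :=
  @insubd 'M[F]_2 _ {'GL_2[F]} 1%g (borel_mx a b).
(* F is also a finite group for its addition: without the scope, the numeral 1
   in borel 1 b could be read as the neutral element of that group, 0. *)
Arguments borel (a b)%_ring_scope.

Lemma val_borel a b : a != 0 -> GLval (borel a b) = borel_mx a b.
Proof.
move=> nz_a; apply: (@insubdK 'M[F]_2 _ {'GL_2[F]} 1%g).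
by rewrite -topredE /= unitmxE det_borel_mx // GRing.unitr1.
Qed.

Lemma borelM a b a' b' : a != 0 -> a' != 0 ->
  (borel a b * borel a' b')%g = borel (a * a') (b * a' + a^-1 * b').
Proof.
move=> nz_a nz_a'; apply: val_inj.
rewrite [LHS]GL_ME [RHS]val_borel ?GRing.mulf_neq0 // !val_borel //.
exact: mul_borel_mx.
Qed.

Lemma borel_SL a b : a != 0 -> borel a b \in 'SL_2[F]%G.
Proof. by move=> nz_a; rewrite inE val_borel // det_borel_mx. Qed.

Lemma borel1_inj : injective (borel 1).
Proof.
move=> b b' /(congr1 (fun u : {'GL_2[F]} => GLval u ord_max 0)).
by rewrite /= !val_borel ?GRing.oner_neq0 // !mxE.
Qed.

Lemma borel1M b b' : (borel 1 b * borel 1 b')%g = borel 1 (b + b').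
Proof.
by rewrite borelM ?GRing.oner_neq0 // GRing.invr1 !(GRing.mul1r, GRing.mulr1).
Qed.

Lemma borel1_0 : borel 1 0 = 1%g.
Proof. by apply: (mulgI (borel 1 0)); rewrite mulg1 borel1M GRing.addr0. Qed.

(** Diagonal matrices act on unitriangular ones through the squares of F. *)
Lemma borel1J a b : a != 0 -> (borel 1 b ^ borel a 0)%g = borel 1 (a ^+ 2 * b).
Proof.
move=> nz_a; apply: (mulgI (borel a 0)).
rewrite -conjgC !borelM ?GRing.oner_neq0 //.
rewrite !(GRing.mul1r, GRing.mulr1, GRing.mulr0, GRing.addr0, GRing.add0r).
by rewrite GRing.expr2 -GRing.mulrA GRing.mulKf // GRing.mulrC.
Qed.

Definition unitri := [set borel 1 b | b in [set: F]].

Lemma unitri_group_set : group_set unitri.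
Proof.
apply/group_setP; split=> [|u v]; first by rewrite -borel1_0 imset_f.
by case/imsetP=> b _ -> /imsetP[b' _ ->]; rewrite borel1M imset_f.
Qed.
Canonical unitri_group := Group unitri_group_set.

Lemma card_unitri : #|unitri| = #|F|.
Proof. by rewrite card_imset ?cardsT //; apply: borel1_inj. Qed.

Lemma unitri_SL : unitri \subset 'SL_2[F]%G.
Proof.
by apply/subsetP=> _ /imsetP[b _ ->]; rewrite borel_SL ?GRing.oner_neq0.
Qed.

Lemma borel_norm_unitri a : a != 0 -> borel a 0 \in 'N(unitri).
Proof.
move=> nz_a; rewrite inE; apply/subsetP=> _ /imsetP[_ /imsetP[b _ ->] ->].
by rewrite borel1J // imset_f.
Qed.

(** Squaring is the Frobenius endomorphism, which is injective, hence bijective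
    as F is finite. *)
Lemma sqrt_pchar2 a : 2 \in [pchar F] -> exists b, a = b ^+ 2.
Proof.
move=> charF2; have inj_sq := GRing.fmorph_inj (GRing.pFrobenius_aut charF2).
by have [g _ gK] := injF_bij inj_sq; exists (g a); rewrite -[LHS]gK.
Qed.

(** By borel1J, the matrix borel 1 1 is conjugate to borel 1 (a ^+ 2), and
    a ^+ 2 can be any nonzero element of F. *)
Lemma trans_norm_unitri :
  2 \in [pchar F] -> [transitive 'N_('SL_2[F])(unitri), on unitri^# | 'J]%g.
Proof.
move=> charF2; have nz1: (1 : F)%R != 0 := GRing.oner_neq0.
have nz_b b : b != 0 -> borel 1 b \in (unitri^#)%g.
  move=> nzb; rewrite !inE imset_f // andbT -borel1_0.
  by rewrite (inj_eq borel1_inj).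
apply/imsetP; exists (borel 1 1); first exact: nz_b.
apply/setP=> u; apply/idP/idP=> [|/imsetP[y /setIP[_ Ny] ->]].
  case/setD1P=> nt_u /imsetP[b _ def_u].
  have nzb: b != 0 by apply: contraNneq nt_u => b0; rewrite def_u b0 borel1_0.
  have [a def_b] := sqrt_pchar2 b charF2.
  have nz_a: a != 0.
    by apply: contraNneq nzb => a0; rewrite def_b a0 GRing.expr0n.
  apply/orbitP; exists (borel a 0).
    by rewrite inE borel_norm_unitri ?andbT ?borel_SL.
  by rewrite /= borel1J // GRing.mulr1 -def_b.
by rewrite memJ_norm ?normD1 // nz_b.
Qed.

End Borel.

Theorem lemma6p2 (c : nat) (c_gt1 : 1 < c)
    (F : finFieldType) (cardF : #|F| = (2 ^ c)%N) :
  exists (Omega : finType) (to : action 'SL_2[F]%G Omega),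
    [transitive 'SL_2[F]%G, on [set: Omega] | to] /\
    c <= max_minimal_base to.
Proof.
have charF2: 2 \in [pchar F]%R := card_finPcharP cardF isT.
apply: (fusion_minimal_base (U := unitri_group F) (p := 2)) => //.
- exact: ltnW.
- exact: unitri_SL.
- by rewrite card_unitri.
exact: trans_norm_unitri.
Qed.
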